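(* Let $\lambda>0$ and $\pi\in\mathcal M$. For any sequence $Z_1,\dots,Z_n\in\mathcal Z$, the online SeqRand algorithm run with $\delta_\lambda(Z,g,g')=\frac\lambda2[L(Z,g)-L(Z,g')]^2$ and $\hat\pi(\rho)=\rho$ for all $\rho\in\mathcal M$ satisfies $$\mathbb E\sum_{i=1}^nL(Z_i,\hat g_{i-1})\le\min_{\rho\in\mathcal M}\Big\{\mathbb E_{g\sim\rho}\sum_{i=1}^nL(Z_i,g)+\frac\lambda2\,\mathbb E_{g\sim\rho}\,\mathbb E\sum_{i=1}^n\big[L(Z_i,g)-L(Z_i,\hat g_{i-1})\big]^2+\frac{K(\rho,\pi)}\lambda\Big\},$$ where $\mathbb E$ (without subscript) denotes expectation with respect to the joint distribution of the drawn functions $\hat g_0,\dots,\hat g_{n-1}$.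
   Context: Setting: $\mathcal Z=\mathcal X\times\mathcal Y$; a prediction function is a measurable map $\mathcal X\to\mathcal Y$; $\mathcal G$ is a measurable space of prediction functions and $\mathcal M$ the set of probability distributions on $\mathcal G$. $L(z,g)\in\mathbb R$ is the loss of $g$ on $z\in\mathcal Z$. No probabilistic assumption is made on the data $Z_1,\dots,Z_n$, which is an arbitrary sequence. All quantities are implicitly assumed measurable and the expectations well defined. $K(\rho,\pi)=\mathbb E_{g\sim\rho}\log\frac{d\rho}{d\pi}(g)$ if $\rho\ll\pi$, and $+\infty$ otherwise. For measurable $h:\mathcal G\to\mathbb R$, $\pi_{-h}(dg)=\frac{e^{-h(g)}}{\mathbb E_{g'\sim\pi}e^{-h(g')}}\pi(dg)$. Online SeqRand algorithm in this case: set $S_0\equiv0$, draw $\hat g_0$ from $\pi$ and predict according to $\hat g_0$ for $Z_1$. For $i=1,\dots,n-1$, define $S_i(g)=S_{i-1}(g)+L(Z_i,g)+\frac\lambda2[L(Z_i,g)-L(Z_i,\hat g_{i-1})]^2$ for $g\in\mathcal G$, draw $\hat g_i$ from $\pi_{-\lambda S_i}$ and predict according to $\hat g_i$ for $Z_{i+1}$. *)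

(* Defs.v *)
From HB Require Import structures.
From mathcomp Require Import all_boot all_order all_algebra.
From mathcomp Require Import all_classical all_reals all_analysis.
From mathcomp Require Import measurable_realfun lebesgue_measure.

Set Implicit Arguments.
Unset Strict Implicit.
Unset Printing Implicit Defensive.

Import Order.TTheory GRing.Theory Num.Theory.
Import numFieldNormedType.Exports.

Local Open Scope classical_set_scope.
Local Open Scope ring_scope.

Definition KL (R : realType) (d : measure_display) (G : measurableType d)
    (rho pi : probability G R) : \bar R :=
  if `[< rho `<< pi >] then
    (\int[rho]_g lne (Radon_Nikodym (charge_of_finite_measure rho) pi g))%E
  else +oo%E.

(* [rho] is the Gibbs distribution pi_{-h}.  A relation rather than a function:
   when the normalizing constant is infinite the quotient is 0 everywhere, so no
   probability [rho] satisfies it.  *)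
Definition is_gibbs (R : realType) (d : measure_display) (G : measurableType d)
    (pi : probability G R) (h : G -> R) (rho : probability G R) : Prop :=
  forall A : set G, measurable A ->
    rho A = ((\int[pi]_(g in A) (expR (- h g))%:E)
             / 'E_pi[fun g => expR (- h g)])%E.

(* [kappa] is a regular version of the conditional distribution of [X] given the
   sigma-algebra [F]. *)
Definition cond_law (R : realType) (dO d : measure_display)
    (Omega : measurableType dO) (G : measurableType d)
    (P : probability Omega R) (F : set_system Omega) (X : Omega -> G)
    (kappa : Omega -> probability G R) : Prop :=
  forall A : set G, measurable A ->
    (forall C : set (\bar R), measurable C ->
       F ((fun w => kappa w A) @^-1` C)) /\
    (forall B : set Omega, F B ->
       P (B `&` X @^-1` A) = (\int[P]_(w in B) kappa w A)%E).

(* sigma(X_0, ..., X_{i-1}) *)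
Definition history (dO d : measure_display) (Omega : measurableType dO)
    (G : measurableType d) (X : nat -> Omega -> G) (i : nat) :
    set_system Omega :=
  <<s \bigcup_(j < i) preimage_set_system setT (X j) measurable >>.

(* The data are Z 1, Z 2, ...; S_i depends on g_0, ..., g_{i-1} only. *)
Fixpoint cumulated_loss (R : realType) (TZ G : Type) (L : TZ -> G -> R)
    (delta : TZ -> G -> G -> R) (Z : nat -> TZ) (gs : nat -> G)
    (i : nat) (g : G) : R :=
  if i is j.+1 then
    cumulated_loss L delta Z gs j g + L (Z i) g + delta (Z i) g (gs j)
  else 0.

(* The draws ghat 0, ..., ghat (n-1) of the online SeqRand algorithm, on an
   arbitrary probability space: [post i w] is pi_{-lambda S_i}, and ghat i is
   drawn from its image by [pihat] conditionally on the previous draws. *)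
Definition online_SeqRand (R : realType) (TZ : Type)
    (dG dO : measure_display) (G : measurableType dG)
    (Omega : measurableType dO) (L : TZ -> G -> R) (lambda : R)
    (delta : TZ -> G -> G -> R)
    (pihat : probability G R -> probability G R) (pi : probability G R)
    (n : nat) (Z : nat -> TZ) (P : probability Omega R)
    (ghat : nat -> {RV P >-> G}) : Prop :=
  (forall A : set G, measurable A -> P (ghat 0%N @^-1` A) = pihat pi A) /\
  (forall i : nat, (0 < i < n)%N ->
     exists post : Omega -> probability G R,
       (forall w, is_gibbs pi
          (fun g => lambda *
             cumulated_loss L delta Z (fun j => ghat j w) i g) (post w)) /\
       cond_law P (history (fun j => ghat j : Omega -> G) i) (ghat i)
         (fun w => pihat (post w))).

(* The sum is in [\bar^d R], where -oo + +oo = +oo: if the expectation E1 is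
   -oo or undefined then E2 is +oo, and the convention makes such a
   rho irrelevant to the minimum (with the default addition the bound would be
   -oo). *)
Definition oracle_bound (R : realType) (TZ : Type)
    (dG dO : measure_display) (G : measurableType dG)
    (Omega : measurableType dO) (L : TZ -> G -> R) (lambda : R)
    (pi : probability G R) (n : nat) (Z : nat -> TZ)
    (P : probability Omega R) (ghat : nat -> {RV P >-> G})
    (rho : probability G R) : \bar R :=
  let E1 : \bar R := 'E_rho[fun g => (\sum_(1 <= i < n.+1) L (Z i) g)%R]%E in
  let E2 : \bar R := (\int[rho]_g 'E_P[fun w =>
      (\sum_(1 <= i < n.+1) (L (Z i) g - L (Z i) (ghat i.-1 w)) ^+ 2)%R])%E in
  (E1 + (lambda / 2)%:E * E2 + (lambda^-1)%:E * KL rho pi)%dE.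

Definition is_minimum (R : realType) (T : Type) (f : T -> \bar R) (m : \bar R) :
    Prop :=
  (exists x, f x = m) /\ (forall x, (m <= f x)%E).

(* Main.v *)
(** Write l_i for L(Z_i, ghat_(i-1)) and psi(x) = exp(x - x^2/2).  Since
    psi(x) + psi(-x) <= 2, for every probability mu the double mu-average of
    psi(lambda L(g') - lambda L(g)) is at most 1.  The posterior pi_(-lambda S_i)
    has density proportional to the product over j <= i of
    psi(lambda l_j - lambda L(Z_j, g)), so the pi-average of this product is a
    nonnegative supermartingale and its expectation is at most 1.

    Let h(g) = E S_n(g) and W = E_pi exp(-lambda h).  Applying 1 + x <= exp x
    under E (in which the mean of S_n(g) is h(g)) and averaging over g with weight
    exp(-lambda h)/W turns that bound into E sum l_i <= -(ln W)/lambda.  By the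
    Gibbs variational principle this value is the minimum of the oracle bound,
    attained at pi_(-lambda h).  All of this needs the l_i to be square
    integrable; otherwise E (L(Z_i, g) - l_i)^2 = +oo for some i and all g, and
    the oracle bound is +oo for every rho. *)

Require Import Defs.
From HB Require Import structures.
From mathcomp Require Import all_boot all_order all_algebra.
From mathcomp Require Import all_classical all_reals all_analysis.
From mathcomp Require Import measurable_realfun lebesgue_measure.
From mathcomp Require Import ring lra.

Set Implicit Arguments.
Unset Strict Implicit.
Unset Printing Implicit Defensive.

Import Order.TTheory GRing.Theory Num.Theory.
Import numFieldNormedType.Exports.

Local Open Scope classical_set_scope.
Local Open Scope ring_scope.

(** * The inequality on psi *)

Lemma ge0_derive_ge (R : realType) (f df : R -> R) (x : R) :
  (forall y, is_derive y (1 : R) f (df y)) ->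
  (forall y, 0 <= y -> 0 <= df y) -> 0 <= x -> f 0 <= f x.
Proof.
move=> fdf df0 x0.
have := @MVT_segment R f df 0 x x0 (fun y _ => fdf y).
case=> [|c /[!in_itv]/= /andP[c0 _] fc].
  apply/continuous_subspaceT => y.
  by apply/differentiable_continuous/derivable1_diffP; case: (fdf y).
by rewrite -subr_ge0 fc mulr_ge0 ?subr0 ?df0.
Qed.

(** This is [cosh x <= exp (x^2 / 2)] in disguise. By evenness take [0 <= x]; the left side equals 2
    at 0 and is nonincreasing from there on. *)
Lemma expR_symmetrized_le2 (R : realType) (x : R) :
  expR (x - x ^+ 2 / 2) + expR (- x - (- x) ^+ 2 / 2) <= 2.
Proof.
wlog x0 : x / 0 <= x => [H|].
  have [/H//|/ltW x0] := leP 0 x.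
  by have := H (- x); rewrite opprK addrC oppr_ge0 => /(_ x0).
rewrite sqrrN.
(* This is the sign of the derivative below. It vanishes at 0, and its own derivative is nonnegative
   because [1 - 2 z <= exp (- 2 z)]. *)
have key (y : R) : 0 <= y -> 0 <= (1 + y) - (1 - y) * expR (2 * y).
  move=> y0; pose f (z : R) := (1 + z) - (1 - z) * expR (2 * z).
  rewrite -/(f y); have -> : 0 = f 0 by rewrite /f mulr0 expR0; ring.
  apply: (@ge0_derive_ge R _ (fun z => 1 - (1 - 2 * z) * expR (2 * z))) => //.
    move=> z; rewrite /f; apply: is_derive_eq.
    rewrite /GRing.scale/=; ring.
  move=> z z0; rewrite subr_ge0 -ler_pdivlMr ?expR_gt0// mul1r -expRN.
  by apply: le_trans (expR_ge1Dx _); lra.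
pose f (z : R) := - (expR (z - z ^+ 2 / 2) + expR (- z - z ^+ 2 / 2)).
suff : f 0 <= f x by rewrite /f expr0n /= !mul0r !subr0 oppr0 expR0; lra.
apply: (@ge0_derive_ge R f
  (fun z => expR (- z - z ^+ 2 / 2) * ((1 + z) - (1 - z) * expR (2 * z)))) => //.
  move=> z; rewrite /f; apply: is_derive_eq.
  rewrite /GRing.scale/= (_ : z - z ^+ 2 / 2 = (- z - z ^+ 2 / 2) + 2 * z); last lra.
  rewrite expRD !mulr0 add0r (_ : 2^-1 * (z * 1 + z * 1) = z); first ring.
  by field.
by move=> z z0; rewrite mulr_ge0 ?expR_ge0 ?key.
Qed.

(** * Measures with densities and disintegration *)

Lemma ex_density_probability (R : realType) (d : measure_display)
    (T : measurableType d) (mu : {measure set T -> \bar R}) (f : T -> \bar R) :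
  measurable_fun setT f -> (forall x, 0 <= f x)%E ->
  (\int[mu]_x f x = 1)%E ->
  exists nu : probability T R, forall A, measurable A ->
    nu A = (\int[mu]_(x in A) f x)%E.
Proof.
move=> mf f0 f1.
pose m (A : set T) := (\int[mu]_(x in A) f x)%E.
have m0 : m set0 = 0%E by rewrite /m integral_set0.
have mge0 A : (0 <= m A)%E by exact: integral_ge0.
have msa : semi_sigma_additive m.
  move=> /= A mA tA mUA; rewrite /m ge0_integral_bigcup//; last exact: measurable_funTS.
  apply: is_cvg_ereal_nneg_natsum_cond => n _ _.
  exact: mge0.
pose mm : {measure set T -> \bar R} :=
  HB.pack m (isMeasure.Build _ _ _ m m0 mge0 msa).
pose pm : probability T R :=
  HB.pack m mm (Measure_isProbability.Build _ _ _ mm f1).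
by exists pm.
Qed.

(** The density [f] and the Radon-Nikodym derivative have the same integral over every measurable
    set, so they agree [mu]-almost everywhere, and the change of variables for the derivative
    carries over to [f]. *)
Lemma ge0_integral_density (R : realType) (d : measure_display)
    (T : measurableType d) (mu : {sigma_finite_measure set T -> \bar R})
    (nu : {finite_measure set T -> \bar R}) (f g : T -> \bar R) :
  measurable_fun setT f -> (forall x, 0 <= f x)%E ->
  (forall A, measurable A -> nu A = \int[mu]_(x in A) f x)%E ->
  measurable_fun setT g -> (forall x, 0 <= g x)%E ->
  (\int[nu]_x g x = \int[mu]_x (g x * f x))%E.
Proof.
move=> mf f0 nuf mg g0.
have numu : nu `<< mu.
  apply/null_content_dominatesP => A mA muA.
  by rewrite nuf// null_set_integral//; exact: measurable_funTS.
rewrite -(Radon_Nikodym_SigmaFinite.change_of_variables numu)//.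
have mr : measurable_fun setT (Radon_Nikodym_SigmaFinite.f nu mu).
  exact/measurable_int/Radon_Nikodym_SigmaFinite.f_integrable.
have r0 := Radon_Nikodym_SigmaFinite.f_ge0 numu.
apply: ge0_ae_eq_integral => //.
- exact: emeasurable_funM.
- exact: emeasurable_funM.
- by move=> x _; rewrite mule_ge0.
- by move=> x _; rewrite mule_ge0.
have : ae_eq mu setT (Radon_Nikodym_SigmaFinite.f nu mu) f.
  apply: integral_ae_eq => //.
    exact: Radon_Nikodym_SigmaFinite.f_integrable.
  by move=> A _ mA; rewrite -nuf// -Radon_Nikodym_SigmaFinite.f_integral.
by apply: filterS => x /= /[apply] ->.
Qed.

Lemma ex_density_probability_integral (R : realType) (d : measure_display)
    (T : measurableType d) (mu : {sigma_finite_measure set T -> \bar R})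
    (f : T -> \bar R) :
  measurable_fun setT f -> (forall x, 0 <= f x)%E ->
  (\int[mu]_x f x = 1)%E ->
  exists2 nu : probability T R,
    (forall A, measurable A -> nu A = \int[mu]_(x in A) f x)%E &
    (forall g, measurable_fun setT g -> (forall x, 0 <= g x) ->
       \int[nu]_x g x = \int[mu]_x (g x * f x))%E.
Proof.
move=> mf f0 f1; have [nu nuE] := ex_density_probability mf f0 f1.
by exists nu => // g mg g0; exact: ge0_integral_density.
Qed.

(** The joint law of [(T, X)] has density [p] with respect to the product of the law of [T] and
    [pi]: the hypothesis says so on rectangles, which are stable under intersection and generate the
    product sigma-algebra. *)
Lemma ge0_integral_cond_density (R : realType) (dO dS dG : measure_display)
    (Omega : measurableType dO) (S : measurableType dS) (G : measurableType dG)
    (P : probability Omega R) (pi : probability G R)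
    (T : {RV P >-> S}) (X : {RV P >-> G}) (p f : S * G -> \bar R) :
  measurable_fun setT p -> (forall z, 0 <= p z)%E ->
  (forall B A, measurable B -> measurable A ->
     P (T @^-1` B `&` X @^-1` A) =
     \int[P]_(w in T @^-1` B) \int[pi]_(g in A) p (T w, g))%E ->
  measurable_fun setT f -> (forall z, 0 <= f z)%E ->
  (\int[P]_w f (T w, X w) = \int[P]_w \int[pi]_g (f (T w, g) * p (T w, g)))%E.
Proof.
move=> mp p0 H mf f0.
have mTX : measurable_fun setT (fun w => (T w, X w)) by exact: measurable_fun_pair.
pose TX : {RV P >-> (S * G)%type} :=
  HB.pack (fun w => (T w, X w)) (isMeasurableFun.Build _ _ _ _ _ mTX).
have [PT PTE] : exists PT : probability S R, forall h, measurable_fun setT h ->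
    (forall s, 0 <= h s)%E -> (\int[PT]_s h s = \int[P]_w h (T w))%E.
  by exists (distribution P T) => h mh h0; rewrite ge0_integral_distribution.
pose mu : probability (S * G)%type R := (PT \x pi)%E.
have intE (h : S * G -> \bar R) : measurable_fun setT h -> (forall z, 0 <= h z)%E ->
    (\int[mu]_z h z = \int[P]_w \int[pi]_g h (T w, g))%E.
  move=> mh h0; rewrite fubini_tonelli1//= PTE//.
    exact: measurable_fun_fubini_tonelli_F.
  by move=> y; exact: integral_ge0.
(* The total mass of [p] is 1 by the rectangle hypothesis with [B] and [A] the whole spaces. *)
have [|nu nuE nuI] := ex_density_probability_integral (mu := mu) mp p0.
  rewrite intE//.
  have := H setT setT measurableT measurableT.
  by rewrite !preimage_setT setIT probability_setT => ->.
pose rect := [set B `*` A | B in @measurable _ S & A in @measurable _ G].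
have rectE C : rect C -> distribution P TX C = nu C.
  move=> [B mB [A mA <-]]; rewrite nuE; last exact: measurableX.
  rewrite integral_mkcond intE; last 2 first.
  - by apply/(measurable_restrictT _ _).1 => //; [exact: measurableX|exact: measurable_funTS].
  - by move=> z; exact: erestrict_ge0.
  rewrite /= /distribution /pushforward (_ : _ @^-1` _ = T @^-1` B `&` X @^-1` A)//.
  rewrite H// integral_mkcond; apply: eq_integral => w _.
  rewrite patchE; case: ifPn => wB.
    rewrite integral_mkcond; apply: eq_integral => g _; rewrite !patchE.
    by rewrite in_setX (_ : (T w \in B) = true).
  rewrite integral0_eq// => g _; rewrite patchE in_setX.
  by rewrite (_ : (T w \in B) = false)//; apply: negbTE.
have nuTX A : measurable A -> distribution P TX A = nu A.
  apply: (measure_unique rect (fun=> setT)) => //.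
  - exact: measurable_prod_measurableType.
  - move=> _ _ [A1 mA1 [A2 mA2 <-]] [B1 mB1 [B2 mB2 <-]].
    exists (A1 `&` B1); first exact: measurableI.
    exists (A2 `&` B2); first exact: measurableI.
    by rewrite setXI.
  - by move=> _; exists setT => //; exists setT => //; rewrite setXTT.
  - by rewrite bigcup_const//; exists 0%N.
  - by move=> k; rewrite [ltLHS]probability_setT ltry.
transitivity (\int[distribution P TX]_z f z)%E.
  by rewrite ge0_integral_distribution.
transitivity (\int[nu]_z f z)%E.
  by apply: eq_measure_integral => A mA _; exact: nuTX.
transitivity (\int[mu]_z (f z * p z))%E.
  exact: nuI.
apply: (intE (fun z => f z * p z)%E); first exact: emeasurable_funM.
by move=> z; exact: mule_ge0.
Qed.

(** * One step of the supermartingale *)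

Section exponential_supermartingale.
Context (R : realType) (dG : measure_display) (G : measurableType dG).
Variable (pi : probability G R).

Definition psi (x : R) : R := expR (x - x ^+ 2 / 2).

Lemma psi_gt0 x : 0 < psi x. Proof. exact: expR_gt0. Qed.

Lemma measurable_psi : measurable_fun setT psi.
Proof.
apply: measurableT_comp => //; apply: measurable_funB => //.
by apply: measurable_funM => //; exact: measurable_funX.
Qed.

Lemma psi_symmetrized_le2 x : psi x + psi (- x) <= 2.
Proof. exact: expR_symmetrized_le2. Qed.

Lemma psi_le2 x : psi x <= 2.
Proof.
apply: le_trans (psi_symmetrized_le2 x).
by rewrite lerDl ltW// psi_gt0.
Qed.

(** Exchanging [g] and [g'] keeps the weight [b g * b g'] and flips the sign of the argument of
    [psi], so twice the left side averages [psi x + psi (- x) <= 2]. The weight stays unnormalized,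
    hence the factor [m * m]. *)
Lemma integral_psi_le (b l : G -> R) (m : R) :
  measurable_fun setT b -> (forall g, 0 <= b g) -> measurable_fun setT l ->
  (\int[pi]_g (b g)%:E = m%:E)%E ->
  (\int[pi]_g' ((\int[pi]_g (b g * psi (l g' - l g))%:E) * (b g')%:E)
    <= (m * m)%:E)%E.
Proof.
move=> mb b0 ml bm.
pose J (z : G * G) : \bar R := (b z.1 * b z.2 * psi (l z.1 - l z.2))%:E.
have mJ : measurable_fun setT J.
  apply/measurable_EFinP; apply: measurable_funM; first apply: measurable_funM.
  - by apply: measurableT_comp.
  - by apply: measurableT_comp.
  - apply: measurableT_comp; first exact: measurable_psi.
    by apply: measurable_funB; exact: measurableT_comp.
have J0 z : (0 <= J z)%E by rewrite lee_fin !mulr_ge0// ltW// psi_gt0.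
pose J' (z : G * G) : \bar R := J (z.2, z.1).
have mJ' : measurable_fun setT J'.
  by apply: measurableT_comp => //; exact: measurable_fun_pair.
have J'0 z : (0 <= J' z)%E by exact: J0.
have -> : (\int[pi]_g' ((\int[pi]_g (b g * psi (l g' - l g))%:E) * (b g')%:E) =
    \int[pi]_x \int[pi]_y J (x, y))%E.
  apply: eq_integral => x _; rewrite -ge0_integralZr//=; last 3 first.
  - apply/measurable_EFinP; apply: measurable_funM => //.
    apply: measurableT_comp; first exact: measurable_psi.
    exact: measurable_funB.
  - by move=> g _; rewrite lee_fin mulr_ge0// ltW// psi_gt0.
  - by rewrite lee_fin.
  apply: eq_integral => y _; rewrite /J -EFinM/=; congr EFin; ring.
(* Of the two copies of the double integral, one is rewritten by Tonelli in the other order, so that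
   they can be added pointwise. *)
rewrite -(@lee_pmul2l _ 2%:E)//.
rewrite mule_natl mule2n [X in (_ + X <= _)%E](fubini_tonelli _ mJ J0).
rewrite -ge0_integralD//; last 4 first.
- by move=> x _; exact: integral_ge0.
- exact: (measurable_fun_fubini_tonelli_F J).
- by move=> x _; exact: integral_ge0.
- exact: (measurable_fun_fubini_tonelli_G J).
have -> : (2%:E * (m * m)%:E = \int[pi]_x \int[pi]_y (2 * (b x * b y))%:E)%E.
  under eq_integral => x _.
    under eq_integral => y _ do rewrite mulrA EFinM.
    rewrite ge0_integralZl//; last 3 first.
    - exact/measurable_EFinP.
    - by move=> y _; rewrite lee_fin.
    - by rewrite lee_fin mulr_ge0.
    rewrite bm -EFinM mulrAC EFinM; over.
  rewrite ge0_integralZl//.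
  - by rewrite bm -!EFinM mulrA.
  - exact/measurable_EFinP.
  - by move=> y _; rewrite lee_fin.
  - by rewrite lee_fin mulr_ge0// -lee_fin -bm integral_ge0// => g _; rewrite lee_fin.
apply: ge0_le_integral => //.
- by move=> x _; apply: adde_ge0; exact: integral_ge0.
- apply: emeasurable_funD.
    exact: (measurable_fun_fubini_tonelli_F J).
  exact: (measurable_fun_fubini_tonelli_G J).
- apply: (measurable_fun_fubini_tonelli_F (fun z => (2 * (b z.1 * b z.2))%:E)).
    apply/measurable_EFinP; apply: measurable_funM => //.
    by apply: measurable_funM; exact: measurableT_comp.
  by move=> z; rewrite lee_fin !mulr_ge0.
move=> x _; rewrite -ge0_integralD//; last 2 first.
- exact: (measurable_fun_pair2 x mJ).
- exact: (measurable_fun_pair2 x mJ').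
apply: ge0_le_integral => //.
- by move=> y _; apply: adde_ge0.
- apply: emeasurable_funD.
    exact: (measurable_fun_pair2 x mJ).
  exact: (measurable_fun_pair2 x mJ').
- by apply/measurable_EFinP; apply: measurable_funM => //; exact: measurable_funM.
move=> y _; rewrite /J -EFinD lee_fin/= (mulrC (b y)) -mulrDr mulrC.
by rewrite -(opprB (l x)) ler_wpM2r ?mulr_ge0// psi_symmetrized_le2.
Qed.

End exponential_supermartingale.

(** If the integral were 0, [b] would vanish almost everywhere, hence at some point since [pi] has
    mass 1. *)
Lemma integral_gt0_bounded (R : realType) (d : measure_display)
    (G : measurableType d) (pi : probability G R) (b : G -> R) (C : R) :
  measurable_fun setT b -> (forall g, 0 < b g) -> (forall g, b g <= C) ->
  exists2 m : R, 0 < m & (\int[pi]_g (b g)%:E = m%:E)%E.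
Proof.
move=> mb b0 bC.
have mEb : measurable_fun setT (EFin \o b) by exact/measurable_EFinP.
have I0 : (0 <= \int[pi]_g (b g)%:E)%E.
  by apply: integral_ge0 => g _; rewrite lee_fin ltW.
have Ioo : (\int[pi]_g (b g)%:E < +oo)%E.
  apply: (@le_lt_trans _ _ (\int[pi]_g (cst C%:E g))%E).
    apply: ge0_le_integral => //; first by move=> g _; rewrite lee_fin ltW.
    by move=> g _; rewrite lee_fin.
  by rewrite integral_cst// [X in (_ * X)%E]probability_setT mule1 ltry.
exists (fine (\int[pi]_g (b g)%:E)%E); last by rewrite fineK// ge0_fin_numE.
apply: fine_gt0; rewrite Ioo andbT lt_neqAle I0 andbT; apply/eqP => /esym Ie0.
have /(ae_eq_integral_abs pi measurableT mEb) : (\int[pi]_g `|(EFin \o b) g| = 0)%E.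
  by rewrite -Ie0; apply: eq_integral => g _; rewrite /= ger0_norm// ltW.
have pi0 : (0 < pi setT)%E by rewrite probability_setT lte_fin.
move=> /(@filter_ex _ _ (ae_properfilter_algebraOfSetsType pi0))[g /(_ I)/= [bg0]].
by have := b0 g; rewrite bg0 ltxx.
Qed.

(** Here [T] is the past and, given [T], [X] has density [a (T, _)] divided by its mass. Integrating
    [X] out leaves, for each past, the double integral of [integral_psi_le] over the mass; it is at
    most mass squared over mass. *)
Lemma integral_psi_cond_le (R : realType) (dO dS dG : measure_display)
    (Omega : measurableType dO) (S : measurableType dS) (G : measurableType dG)
    (P : probability Omega R) (pi : probability G R)
    (T : {RV P >-> S}) (X : {RV P >-> G}) (a : S * G -> R) (C : R) (l : G -> R) :
  measurable_fun setT a -> (forall z, 0 < a z) -> (forall z, a z <= C) ->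
  measurable_fun setT l ->
  (forall B A, measurable B -> measurable A ->
     P (T @^-1` B `&` X @^-1` A) =
     \int[P]_(w in T @^-1` B)
       ((\int[pi]_(g in A) (a (T w, g))%:E) / (\int[pi]_g (a (T w, g))%:E)))%E ->
  (\int[P]_w \int[pi]_g (a (T w, g) * psi (l (X w) - l g))%:E <=
   \int[P]_w \int[pi]_g (a (T w, g))%:E)%E.
Proof.
move=> ma a0 aC ml H.
have mas s : measurable_fun setT (fun g => a (s, g)) by exact: measurable_fun_pair2.
pose M s := fine (\int[pi]_g (a (s, g))%:E)%E.
have [M0 ME] : (forall s, 0 < M s) /\ (forall s, \int[pi]_g (a (s, g))%:E = (M s)%:E)%E.
  split=> s; have [m m0 mE] := integral_gt0_bounded pi (mas s) (fun g => a0 (s, g))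
    (fun g => aC (s, g)); by rewrite /M mE.
have mM : measurable_fun setT M.
  apply: measurableT_comp; first exact: fine_measurable.
  apply: (measurable_fun_fubini_tonelli_F (EFin \o a)); first exact/measurable_EFinP.
  by move=> z; rewrite lee_fin ltW.
(* 1 / M, in a form whose measurability is immediate *)
pose k s := expR (- ln (M s)).
have kE s : k s = (M s)^-1 by rewrite /k expRN lnK// posrE.
have mk : measurable_fun setT k.
  apply: measurableT_comp => //; apply: measurableT_comp => //.
  by apply: measurableT_comp => //; exact: measurable_ln.
pose p (z : S * G) := (a z * k z.1)%:E.
pose F (z : S * G * G) := (a (z.1.1, z.2) * psi (l z.1.2 - l z.2))%:E.
pose f (z : S * G) := (\int[pi]_g F (z, g))%E.
have mF : measurable_fun setT F.
  apply/measurable_EFinP; apply: measurable_funM.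
    apply: measurableT_comp => //; apply: measurable_fun_pair => //.
    by apply: measurableT_comp.
  apply: measurableT_comp; first exact: measurable_psi.
  apply: measurable_funB; apply: measurableT_comp => //.
  exact: measurableT_comp.
have F0 z : (0 <= F z)%E by rewrite lee_fin mulr_ge0// ltW// psi_gt0.
have mf : measurable_fun setT f by exact: measurable_fun_fubini_tonelli_F.
have f0 z : (0 <= f z)%E by apply: integral_ge0 => g _; exact: F0.
have mp : measurable_fun setT p.
  by apply/measurable_EFinP; apply: measurable_funM => //; exact: measurableT_comp.
have p0 z : (0 <= p z)%E by rewrite lee_fin mulr_ge0 ?expR_ge0// ltW.
have Hp B A : measurable B -> measurable A -> (P (T @^-1` B `&` X @^-1` A) =
    \int[P]_(w in T @^-1` B) \int[pi]_(g in A) p (T w, g))%E.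
  move=> mB mA; rewrite H//; apply: eq_integral => w _.
  rewrite ME inver gt_eqF// /p/= -kE; under [RHS]eq_integral do rewrite EFinM.
  rewrite ge0_integralZr//.
  - by apply/measurable_EFinP; exact: measurable_funTS.
  - by move=> g _; rewrite lee_fin ltW.
  - by rewrite lee_fin expR_ge0.
have -> : (\int[P]_w \int[pi]_g (a (T w, g) * psi (l (X w) - l g))%:E =
    \int[P]_w f (T w, X w))%E by [].
rewrite (ge0_integral_cond_density mp p0 Hp mf f0).
have mfp : measurable_fun setT (fun z => f z * p z)%E by exact: emeasurable_funM.
have fp0 z : (0 <= f z * p z)%E by rewrite mule_ge0.
apply: ge0_le_integral => //.
- by move=> w _; apply: integral_ge0 => g _; exact: fp0.
- by apply: (measurableT_comp (measurable_fun_fubini_tonelli_F _ mfp fp0)).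
- apply: (measurableT_comp (measurable_fun_fubini_tonelli_F (EFin \o a) _ _)) => //.
    exact/measurable_EFinP.
  by move=> z; rewrite lee_fin ltW.
(* For a fixed past the factor [k] leaves the integral; multiplying by [M] gives the form of
   [integral_psi_le]. *)
move=> w _; rewrite ME /f /F /p/=.
under eq_integral do rewrite (EFinM (a _)) muleA.
rewrite ge0_integralZr//; last 3 first.
- apply: emeasurable_funM; last exact/measurable_EFinP.
  exact: (measurable_fun_pair2 (T w) mf).
- by move=> g _; apply: mule_ge0; [exact: (f0 (T w, g))|rewrite lee_fin ltW].
- by rewrite lee_fin expR_ge0.
rewrite kE -[leLHS]muleC lee_pdivrMl//.
by rewrite -EFinM; apply: integral_psi_le => // g; exact: ltW.
Qed.

(** * The posterior weights along a run *)

Section SeqRand.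
Context (R : realType) (TZ : Type) (dG dO : measure_display)
  (G : measurableType dG) (Omega : measurableType dO).
Variables (L : TZ -> G -> R) (mL : forall z, measurable_fun setT (L z)).
Variables (lambda : R) (pi : probability G R) (Z : nat -> TZ).
Variables (P : probability Omega R) (ghat : nat -> {RV P >-> G}).

(** Up to a factor independent of [g], this is the unnormalized posterior density; that factor is
    chosen so that the [pi]-average becomes a supermartingale. The draw [gs j] predicts for
    [Z j.+1]. *)
Definition excess_weight (gs : nat -> G) (i : nat) (g : G) : R :=
  \prod_(j < i) psi (lambda * L (Z j.+1) (gs j) - lambda * L (Z j.+1) g).

Lemma excess_weight_gt0 gs i g : 0 < excess_weight gs i g.
Proof. by apply: prodr_gt0 => j _; exact: psi_gt0. Qed.

(** This bound makes the normalizing integrals finite. *)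
Lemma excess_weight_le gs i g : excess_weight gs i g <= 2 ^+ i.
Proof.
rewrite -[i in X in _ <= X]card_ord -prodr_const; apply: ler_prod => j _.
by rewrite psi_le2 ltW// psi_gt0.
Qed.

Lemma excess_weight0 gs g : excess_weight gs 0 g = 1.
Proof. by rewrite /excess_weight big_ord0. Qed.

Lemma excess_weightS gs i g : excess_weight gs i.+1 g = excess_weight gs i g *
  psi (lambda * L (Z i.+1) (gs i) - lambda * L (Z i.+1) g).
Proof. by rewrite /excess_weight big_ord_recr. Qed.

(** With [x = lambda l - lambda L], [x - x^2 / 2] is [lambda l] minus [lambda] times the increment
    [L + lambda / 2 (L - l)^2] of the cumulated loss. *)
Lemma excess_weightE gs i g : excess_weight gs i g =
  expR (lambda * \sum_(j < i) L (Z j.+1) (gs j)) *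
  expR (- (lambda * cumulated_loss L
    (fun z g g' => lambda / 2 * (L z g - L z g') ^+ 2) Z gs i g)).
Proof.
rewrite /excess_weight -expRD.
elim: i => [|i IH]; first by rewrite !big_ord0 /= !mulr0 oppr0 addr0 expR0.
rewrite !big_ord_recr/= IH /psi -expRD; congr expR.
by field.
Qed.

(** The parameter space [S] is left free: it will be [unit] for a fixed run, [Omega] with the
    history sigma-algebra, and [Omega] itself. *)
Lemma measurable_excess_weight (d : measure_display) (S : measurableType d)
    (gs : nat -> S -> G) (i : nat) :
  (forall j, (j < i)%N -> measurable_fun setT (gs j)) ->
  measurable_fun setT (fun z : S * G => excess_weight (fun j => gs j z.1) i z.2).
Proof.
move=> mgs; apply: measurable_prod => j _.
apply: measurableT_comp; first exact: measurable_psi.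
apply: measurable_funB; apply: measurable_funM => //.
  apply: measurableT_comp => //; apply: measurableT_comp; [exact: mgs|exact: measurable_fst].
by apply: measurableT_comp => //; exact: measurable_snd.
Qed.

(** The factor [c] relating the two densities does not depend on [g], so it cancels in the quotient;
    the mass being finite and positive, this is a computation in [R]. *)
Lemma is_gibbs_excess_weight gs i rho :
  is_gibbs pi (fun g => lambda * cumulated_loss L
    (fun z g g' => lambda / 2 * (L z g - L z g') ^+ 2) Z gs i g) rho ->
  forall A, measurable A -> (rho A =
    (\int[pi]_(g in A) (excess_weight gs i g)%:E) /
    (\int[pi]_g (excess_weight gs i g)%:E))%E.
Proof.
move=> gibbs A mA; rewrite (gibbs A mA) unlock.
have mw : measurable_fun setT (excess_weight gs i).
  apply: (@measurable_fun_pair2 _ _ _ unit G R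
    (fun z => excess_weight (fun j => gs j) i z.2) tt).
  exact: (@measurable_excess_weight _ unit (fun j => cst (gs j))).
have [m m0 mE] := integral_gt0_bounded pi mw (excess_weight_gt0 gs i)
  (excess_weight_le gs i).
pose c := expR (- (lambda * \sum_(j < i) L (Z j.+1) (gs j))).
have c0 : 0 < c by exact: expR_gt0.
have cw g : expR (- (lambda * cumulated_loss L
    (fun z g g' => lambda / 2 * (L z g - L z g') ^+ 2) Z gs i g)) =
    c * excess_weight gs i g.
  by rewrite excess_weightE mulrA /c -expRD addNr expR0 mul1r.
under eq_integral do rewrite cw EFinM.
under [in X in (_ / X)%E]eq_integral do rewrite cw EFinM.
rewrite !ge0_integralZl//; first last.
- by rewrite lee_fin ltW.
- by move=> g _; rewrite lee_fin ltW// excess_weight_gt0.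
- exact/measurable_EFinP/measurable_funTS.
- by rewrite lee_fin ltW.
- by move=> g _; rewrite lee_fin ltW// excess_weight_gt0.
- exact/measurable_EFinP.
rewrite mE -EFinM !inver !gt_eqF ?mulr_gt0//.
rewrite muleC muleA -EFinM muleC; congr (_ * _%:E)%E.
by rewrite invfM mulrAC mulVf ?mul1r// gt_eqF.
Qed.

(** Induction on [i]: the value is 1 at [i = 0], and drawing [ghat i] does not increase it, by
    [integral_psi_cond_le]. *)
Lemma expectation_excess_weight_le1 (n : nat) :
  online_SeqRand L lambda
    (fun z g g' => lambda / 2 * (L z g - L z g') ^+ 2)
    (fun rho => rho) pi n Z ghat ->
  (\int[P]_w \int[pi]_g (excess_weight (fun j => ghat j w) n g)%:E <= 1)%E.
Proof.
move=> [law0 law].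
suff H i : (i <= n)%N ->
  (\int[P]_w \int[pi]_g (excess_weight (fun j => ghat j w) i g)%:E <= 1)%E.
  exact: H.
elim: i => [_|i IH ltin].
  rewrite (eq_integral (cst 1%E)) => [|w _]; last first.
    rewrite (eq_integral (cst 1%E)) => [|g _].
      by rewrite integral_cst// mul1e; exact: probability_setT.
    by rewrite excess_weight0.
  by rewrite integral_cst// mul1e; exact: probability_le1.
apply: le_trans (IH (ltnW ltin)).
have ml : measurable_fun setT (fun g => lambda * L (Z i.+1) g).
  exact: measurable_funM.
under eq_integral do under eq_integral do rewrite excess_weightS.
(* The first draw has the unconditional law [pi]: its past is the one-point space and its weight the
   constant 1. *)
case: (posnP i) => [i0|i_gt0].
  rewrite {}i0 in ml *.
  under eq_integral do under eq_integral do rewrite excess_weight0.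
  under [leRHS]eq_integral do under eq_integral do rewrite excess_weight0.
  pose T : {RV P >-> unit} := [the {mfun Omega >-> unit} of cst tt].
  apply: (@integral_psi_cond_le _ _ _ _ _ unit _ P pi T (ghat 0%N)
    (fun=> 1) 1 (fun g => lambda * L (Z 1%N) g)) => //.
  move=> B A mB mA.
  rewrite (eq_integral (cst (pi A))) => [|w _]; last first.
    rewrite (integral_cst pi mA 1) (integral_cst pi measurableT 1).
    by rewrite [X in (_ / (_ * X))%E]probability_setT !mul1e inve1 mule1.
  rewrite integral_cst; last by rewrite -[_ @^-1` _]setTI; exact: measurable_funP.
  have [Btt|Btt] := pselect (B tt).
    rewrite (_ : T @^-1` B = setT); last by apply/seteqP; split.
    rewrite setTI law0//. by rewrite [X in (_ * X)%E]probability_setT mule1.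
  rewrite (_ : T @^-1` B = set0); last by apply/seteqP; split.
  by rewrite set0I !measure0 mule0.
have [post [gibbs cond]] := law i (introT andP (conj i_gt0 ltin)).
pose C := \bigcup_(j < i) preimage_set_system setT (ghat j : Omega -> G) measurable.
pose S := g_sigma_algebraType C.
have mS (j : nat) : (j < i)%N -> measurable_fun setT (ghat j : S -> G).
  move=> ji _ A mA; suff : <<s C >> (setT `&` ghat j @^-1` A) by [].
  apply: (@sub_sigma_algebra Omega setT C); exists j => //; by exists A.
have mid : measurable_fun setT (id : Omega -> S).
  move=> _ B mB; rewrite setTI preimage_id.
  apply: (smallest_sub _ _ mB); first exact: sigma_algebra_measurable.
  move=> _ [j _ [A mA <-]]; exact: measurable_funP.
pose T : {RV P >-> S} := HB.pack (id : Omega -> S) (isMeasurableFun.Build _ _ _ _ _ mid).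
apply: (@integral_psi_cond_le _ _ _ _ _ S _ P pi T (ghat i)
  (fun z => excess_weight (fun j => ghat j z.1) i z.2) (2 ^+ i)
  (fun g => lambda * L (Z i.+1) g)).
- exact: (@measurable_excess_weight _ S (fun j => (ghat j : S -> G))).
- by move=> z; exact: excess_weight_gt0.
- by move=> z; exact: excess_weight_le.
- by [].
move=> B A mB mA; have [_ /(_ B mB) ->] := cond A mA.
by apply: eq_integral => w _; exact: (is_gibbs_excess_weight (gibbs w) mA).
Qed.

End SeqRand.

(** * Relative entropy *)

(** Positive and negative parts are compared separately, which covers functions of any sign,
    integrable or not. *)
Lemma le_measurable_integral (R : realType) (d : measure_display)
    (G : measurableType d) (mu : {measure set G -> \bar R}) (f g : G -> \bar R) :
  measurable_fun setT f -> measurable_fun setT g -> (forall x, f x <= g x)%E ->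
  (\int[mu]_x f x <= \int[mu]_x g x)%E.
Proof.
move=> mf mg fg; rewrite integralE [leRHS]integralE leeB//.
- apply: ge0_le_integral => //; [exact: measurable_funepos|exact: measurable_funepos|].
  by move=> x xT; apply: (@funepos_le _ _ setT); rewrite ?inE.
- apply: ge0_le_integral => //; [exact: measurable_funeneg|exact: measurable_funeneg|].
  by move=> x xT; apply: (@funeneg_le _ _ setT); rewrite ?inE.
Qed.

Lemma measurable_lne_EFin (R : realType) (d : measure_display)
    (G : measurableType d) (f : G -> R) :
  measurable_fun setT f -> measurable_fun setT (fun x => lne (f x)%:E).
Proof.
move=> mf; apply: measurable_fun_ifT => //; first exact: measurable_fun_ler.
by apply/measurable_EFinP; apply: measurableT_comp => //; exact: measurable_ln.
Qed.

(** The Radon-Nikodym derivative equals [g] almost everywhere for [pi], hence for [rho]. The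
    functions [lne] and [ln] differ at 0, but [g = 0] has [rho]-measure 0. *)
Lemma KL_densityE (R : realType) (d : measure_display) (G : measurableType d)
    (rho pi : probability G R) (g : G -> R) :
  measurable_fun setT g -> (forall x, 0 <= g x) ->
  (forall A, measurable A -> rho A = \int[pi]_(x in A) (g x)%:E)%E ->
  KL rho pi = (\int[rho]_x (ln (g x))%:E)%E.
Proof.
move=> mg g0 rhoE.
have mEg : measurable_fun setT (EFin \o g) by exact/measurable_EFinP.
have rhopi : rho `<< pi.
  apply/null_content_dominatesP => A mA piA.
  by rewrite rhoE// null_set_integral//; exact: measurable_funTS.
rewrite /KL asboolT//.
pose r := Radon_Nikodym (charge_of_finite_measure rho) pi.
have rfin x : r x \is a fin_num by exact: Radon_Nikodym_fin_num.
have ri : pi.-integrable setT r by exact: Radon_Nikodym_integrable.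
have mr : measurable_fun setT r by exact: measurable_int ri.
have rg : ae_eq pi setT r (EFin \o g).
  apply: integral_ae_eq => // A _ mA.
  by rewrite -Radon_Nikodym_integral//= -rhoE.
have {}rg : ae_eq rho setT r (EFin \o g).
  exact: (null_dominates_ae_eq measurableT rhopi rg).
apply: ae_eq_integral => //.
- rewrite (_ : (fun x => lne (r x)) = (fun x => lne (fine (r x))%:E)); last first.
    by apply/funext => x; rewrite fineK.
  by apply: measurable_lne_EFin; apply: measurableT_comp => //; exact: fine_measurable.
- by apply/measurable_EFinP; apply: measurableT_comp => //; exact: measurable_ln.
have mN : measurable [set x | g x = 0].
  by rewrite -[X in measurable X]setTI; exact: (mg measurableT _ (measurable_set1 0)).
have gN0 : {ae rho, forall x, g x != 0}.
  exists [set x | g x = 0]; split => //.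
    rewrite rhoE// (eq_integral (cst 0%E)) ?integral0// => x.
    by rewrite inE/= => ->.
  by move=> x /= /negP/negPn/eqP.
apply: filterS2 rg gN0 => x /= /(_ I) rgx gx0 _; rewrite -/r rgx.
by rewrite lne_EFin// lt_neqAle eq_sym gx0 g0.
Qed.

(** The lower half of the Gibbs variational principle. With [g] the density of [rho] and [u] the
    Gibbs density divided by [g], [ln g >= 1 - ln W - h - u] pointwise, and [u] has [rho]-mean at
    most 1. *)
Lemma KL_ge (R : realType) (d : measure_display) (G : measurableType d)
    (rho pi : probability G R) (h : G -> R) (W H : R) :
  measurable_fun setT h -> 0 < W ->
  (\int[pi]_x (expR (- h x))%:E = W%:E)%E ->
  rho.-integrable setT (EFin \o h) -> (\int[rho]_x (h x)%:E = H%:E)%E ->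
  ((- H - ln W)%:E <= KL rho pi)%E.
Proof.
move=> mh W0 WE hi HE.
have [rhopi|nrhopi] := pselect (rho `<< pi); last first.
  by rewrite /KL asboolF// leey.
pose f := Radon_Nikodym_SigmaFinite.f rho pi.
have ffin x : f x \is a fin_num by exact: Radon_Nikodym_SigmaFinite.f_fin_num.
have f0 x : (0 <= f x)%E by exact: Radon_Nikodym_SigmaFinite.f_ge0.
have mf : measurable_fun setT f.
  exact/measurable_int/Radon_Nikodym_SigmaFinite.f_integrable.
pose g x := fine (f x).
have gE x : (g x)%:E = f x by rewrite fineK.
have g0 x : 0 <= g x by rewrite -lee_fin gE.
have mg : measurable_fun setT g.
  by apply: measurableT_comp => //; exact: fine_measurable.
rewrite (@KL_densityE _ _ _ rho pi g mg g0); last first.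
  move=> A mA; rewrite (Radon_Nikodym_SigmaFinite.f_integral rhopi mA).
  by apply: eq_integral => x _; rewrite gE.
have mlg : measurable_fun setT (fun x => ln (g x)).
  by apply: measurableT_comp => //; exact: measurable_ln.
(* [1 + y <= exp y] at y = - h - ln W - ln g; since [ln 0 = 0] no case
   distinction on [g x = 0] is needed. *)
pose u x := expR (- h x - ln W - ln (g x)).
have mu : measurable_fun setT u.
  apply: measurableT_comp => //; apply: measurable_funB => //.
  by apply: measurable_funB => //; exact: measurableT_comp.
have mEu : measurable_fun setT (EFin \o u) by exact/measurable_EFinP.
(* Under [pi] the integrand becomes [u * g], which is the Gibbs density where [g > 0] and 0
   elsewhere. *)
have u1 : (\int[rho]_x (u x)%:E <= 1)%E.
  rewrite -(Radon_Nikodym_SigmaFinite.change_of_variables rhopi)//; last first.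
    by move=> x; rewrite lee_fin expR_ge0.
  rewrite -/f.
  have -> : 1%E = (\int[pi]_x (W^-1%:E * (expR (- h x))%:E))%E.
    rewrite ge0_integralZl//=; first last.
    - by rewrite lee_fin invr_ge0 ltW.
    - by apply/measurable_EFinP; apply: measurableT_comp => //; exact: measurableT_comp.
    - by rewrite WE -EFinM mulVf// gt_eqF.
  apply: le_measurable_integral.
  - exact: emeasurable_funM.
  - apply/measurable_EFinP; apply: measurable_funM => //.
    by apply: measurableT_comp => //; exact: measurableT_comp.
  move=> x; rewrite -gE -!EFinM lee_fin /u.
  have [gx0|gx0] := leP (g x) 0.
    rewrite (_ : g x = 0) ?mulr0 ?mulr_ge0 ?expR_ge0 ?invr_ge0 ?ltW//.
    by apply/le_anti; rewrite gx0 g0.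
  rewrite !expRD [expR (- ln (g x))]expRN [expR (- ln W)]expRN !lnK ?posrE//.
  by rewrite mulfVK ?gt_eqF// mulrC.
have u_int : rho.-integrable setT (EFin \o u).
  apply/integrableP; split => //.
  under eq_integral do rewrite /= ger0_norm ?expR_ge0//.
  by rewrite (le_lt_trans u1)// ltry.
have t_int : rho.-integrable setT (EFin \o (fun x => 1 - ln W - h x)).
  rewrite (_ : _ \o _ = fun x => (EFin \o cst (1 - ln W)%R) x - (EFin \o h) x)%E.
    by apply: integrableB => //; exact: finite_measure_integrable_cst.
  by apply/funext => x /=; rewrite EFinB.
apply: (@le_trans _ _ (\int[rho]_x (((1 - ln W - h x)%R)%:E - (u x)%:E))%E); last first.
  apply: le_measurable_integral.
  - by apply: emeasurable_funB => //; exact: measurable_int t_int.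
  - exact/measurable_EFinP.
  move=> x; rewrite -EFinB lee_fin.
  by have := expR_ge1Dx (- h x - ln W - ln (g x)); rewrite -/(u x); lra.
rewrite integralB//.
have -> : (\int[rho]_x ((1 - ln W - h x)%R)%:E = (1 - ln W - H)%:E)%E.
  under eq_integral do rewrite EFinB.
  rewrite integralB// ?HE ?integral_cst//; last exact: finite_measure_integrable_cst.
  by rewrite [X in (_ * X - _)%E]probability_setT mule1.
have ufin : (\int[rho]_x (u x)%:E)%E \is a fin_num.
  rewrite ge0_fin_numE; first by rewrite (le_lt_trans u1)// ltry.
  by apply: integral_ge0 => x _; rewrite lee_fin expR_ge0.
by move: u1; rewrite -(fineK ufin) -EFinB !lee_fin; lra.
Qed.

(** * The minimum of the oracle bound *)

Section gibbs_variational.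
Context (R : realType) (d : measure_display) (G : measurableType d).
Variables (pi : probability G R) (s q : G -> R) (lambda c : R).
Hypotheses (lambda_gt0 : 0 < lambda).
Hypotheses (ms : measurable_fun setT s) (mq : measurable_fun setT q).
Hypotheses (q0 : forall g, 0 <= q g).
Hypotheses (sq : forall g, `|s g| <= lambda / 4 * q g + c).

Let h g := lambda * (s g + lambda / 2 * q g).

Let mh : measurable_fun setT h.
Proof.
by apply: measurable_funM => //; apply: measurable_funD => //; exact: measurable_funM.
Qed.

(** Half of the quadratic term of [h] absorbs [s]; the other half remains. So [h] is bounded below
    and controls [q]. *)
Let h_ge g : lambda ^+ 2 / 4 * q g - lambda * c <= h g.
Proof.
have : - s g <= lambda / 4 * q g + c by apply: le_trans (sq g); rewrite -normrN ler_norm.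
by rewrite -(ler_pM2l lambda_gt0) /h; lra.
Qed.

Lemma integral_expRN_gt0 : exists2 W : R, 0 < W &
  (\int[pi]_g (expR (- (lambda * (s g + lambda / 2 * q g))))%:E = W%:E)%E.
Proof.
apply: (@integral_gt0_bounded _ _ _ pi (fun g => expR (- h g)) (expR (lambda * c))).
- by apply: measurableT_comp => //; exact: measurableT_comp.
- by move=> g; exact: expR_gt0.
move=> g; rewrite ler_expR lerNl; apply: le_trans (h_ge g).
by rewrite lerBDr addNr mulr_ge0// divr_ge0// sqr_ge0.
Qed.

Let integral_h (rho : probability G R) : (\int[rho]_g (q g)%:E < +oo)%E ->
  exists S Q : R, [/\ \int[rho]_g (s g)%:E = S%:E, \int[rho]_g (q g)%:E = Q%:E,
    rho.-integrable setT (EFin \o h) &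
    \int[rho]_g (h g)%:E = (lambda * (S + lambda / 2 * Q))%:E]%E.
Proof.
move=> qoo.
have iq : rho.-integrable setT (EFin \o q).
  apply/integrableP; split; first exact/measurable_EFinP.
  by under eq_integral do rewrite /= ger0_norm//.
have iqc : rho.-integrable setT (fun g => (lambda / 4)%:E * (EFin \o q) g + (EFin \o cst c) g)%E.
  apply: integrableD => //; first exact: integrableZl.
  exact: finite_measure_integrable_cst.
have is_ : rho.-integrable setT (EFin \o s).
  apply: (le_integrable measurableT _ _ iqc); first exact/measurable_EFinP.
  by move=> g _; rewrite /= lee_fin (le_trans (sq g))// ler_norm.
have hE : EFin \o h = (fun g => lambda%:E * ((EFin \o s) g + (lambda / 2)%:E * (EFin \o q) g))%E.
  exact/funext.
have isq : rho.-integrable setT (fun g => (EFin \o s) g + (lambda / 2)%:E * (EFin \o q) g)%E.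
  by apply: integrableD => //; exact: integrableZl.
exists (fine (\int[rho]_g (s g)%:E)%E), (fine (\int[rho]_g (q g)%:E)%E).
have sE := fineK (integrable_fin_num measurableT is_).
have qE := fineK (integrable_fin_num measurableT iq).
split; [by rewrite sE|by rewrite qE|by rewrite hE; exact: integrableZl|].
rewrite (_ : (fun g => (h g)%:E) = EFin \o h)// hE integralZl// integralD//; last first.
  exact: integrableZl.
by rewrite integralZl// -sE -qE.
Qed.

(** [KL_ge] applied to [h] gives the lower bound; equality holds at the density [exp (- h) / W]. *)
Lemma gibbs_variational (W : R) : 0 < W ->
  (\int[pi]_g (expR (- (lambda * (s g + lambda / 2 * q g))))%:E = W%:E)%E ->
  is_minimum (fun rho : probability G R =>
    ((\int[rho]_g (s g)%:E)%E + (lambda / 2)%:E * (\int[rho]_g (q g)%:E)%E +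
      (lambda^-1)%:E * KL rho pi)%dE) (- ln W / lambda)%:E.
Proof.
move=> W0 WE; split; last first.
  (* If the mean of [q] is infinite, dual addition makes the whole sum [+oo], whatever the other
     terms. *)
  move=> rho; have [qoo|] := ltP (\int[rho]_g (q g)%:E)%E +oo%E; last first.
    rewrite leye_eq => /eqP ->.
    rewrite gt0_muley ?lte_fin ?divr_gt0// DualAddTheoryNumDomain.daddey.
    by rewrite DualAddTheoryNumDomain.daddeC DualAddTheoryNumDomain.daddey leey.
  have [S [Q [-> -> ih hE]]] := integral_h qoo.
  have := KL_ge mh W0 WE ih hE.
  case: (KL rho pi) => [k| |]; last by rewrite leeNy_eq.
    rewrite -!EFinM -!DualAddTheoryNumDomain.dEFinD !lee_fin => kge.
    rewrite mulrC ler_pdivrMl// mulrDr mulVKf ?gt_eqF//; lra.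
  move=> _; rewrite gt0_muley ?lte_fin ?invr_gt0//.
  by rewrite DualAddTheoryNumDomain.daddey leey.
pose g x := expR (- h x - ln W).
have mg : measurable_fun setT g.
  by apply: measurableT_comp => //; apply: measurable_funB => //; exact: measurableT_comp.
have g0 x : 0 <= g x by exact: expR_ge0.
have gE x : g x = W^-1 * expR (- h x) by rewrite /g expRD [expR (- ln W)]expRN lnK ?posrE// mulrC.
have [|||rho rhoE rhoI] := @ex_density_probability_integral _ _ _ pi (EFin \o g).
- exact/measurable_EFinP.
- by [].
- under eq_integral do rewrite /= gE EFinM.
  rewrite ge0_integralZl//=; first last.
  + by rewrite lee_fin invr_ge0 ltW.
  + apply/measurable_EFinP; apply: measurableT_comp => //.
    exact: measurableT_comp.
  + by rewrite WE -EFinM mulVf// gt_eqF.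
(* [q] times the density is bounded by [C], because [lambda^2 / 4 q <= h + lambda c <= exp (h +
   lambda c)]. *)
have qoo : (\int[rho]_g (q g)%:E < +oo)%E.
  rewrite (rhoI (EFin \o q))//; last exact/measurable_EFinP.
  pose C := (4 / lambda ^+ 2) * (expR (lambda * c) * W^-1).
  apply: (@le_lt_trans _ _ (\int[pi]_x (cst C%:E x))%E); last first.
    by rewrite integral_cst// [X in (_ * X)%E]probability_setT mule1 ltry.
  apply: le_measurable_integral => //.
    by apply/measurable_EFinP; exact: measurable_funM.
  move=> x; rewrite /= -EFinM lee_fin gE /C mulrCA mulrC (mulrA (4 / _)).
  rewrite ler_wpM2r ?invr_ge0 ?(ltW W0)//.
  have l2 : 0 < lambda ^+ 2 / 4 by rewrite divr_gt0 ?exprn_gt0.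
  rewrite (_ : 4 / lambda ^+ 2 = (lambda ^+ 2 / 4)^-1); last by rewrite invf_div.
  rewrite ler_pdivlMl// mulrA -ler_pdivlMr ?expR_gt0// -expRN opprK -expRD.
  by apply: le_trans (expR_ge1Dx _); have := h_ge x; lra.
exists rho.
(* Here [ln g = - h - ln W], so the entropy term cancels [S] and [Q]. *)
have [S [Q [-> -> ih hE]]] := integral_h qoo.
rewrite (KL_densityE mg g0 rhoE).
under eq_integral do rewrite /g expRK EFinB EFinN.
rewrite integralB//; last 2 first.
- exact: integrableN.
- exact: finite_measure_integrable_cst.
have -> : (\int[rho]_x (ln W)%:E = (ln W)%:E)%E.
  by rewrite integral_cst// [X in (_ * X)%E]probability_setT mule1.
rewrite integralN; last exact: integrable_add_def.
rewrite hE -EFinN -EFinB -!EFinM -!DualAddTheoryNumDomain.dEFinD.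
by congr EFin; field; rewrite gt_eqF.
Qed.

End gibbs_variational.

(** * From the weights to the mean loss *)

(** For each [g], the tangent of [exp] at 0 bounds [W exp (h g) V] from below by a function of
    [P]-mean [k], independent of [g]. Averaging over [pi] gives [k <= 1], that is
    [lambda A + ln W <= 0]. *)
Lemma mean_le_free_energy (R : realType) (dO dG : measure_display)
    (Omega : measurableType dO) (G : measurableType dG)
    (P : probability Omega R) (pi : probability G R)
    (U : Omega -> R) (D : G -> Omega -> R) (s q : G -> R) (V : Omega * G -> R)
    (lambda A W : R) :
  0 < lambda -> 0 < W ->
  P.-integrable setT (EFin \o U) -> (\int[P]_w (U w)%:E = A%:E)%E ->
  (forall g, P.-integrable setT (EFin \o D g)) ->
  (forall g, \int[P]_w (D g w)%:E = (q g)%:E)%E ->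
  measurable_fun setT s -> measurable_fun setT q -> measurable_fun setT V ->
  (forall w g, V (w, g) =
     expR (lambda * U w - lambda * s g - lambda ^+ 2 / 2 * D g w)) ->
  (\int[pi]_g (expR (- (lambda * (s g + lambda / 2 * q g))))%:E = W%:E)%E ->
  (\int[P]_w \int[pi]_g (V (w, g))%:E <= 1)%E ->
  A <= - ln W / lambda.
Proof.
move=> l0 W0 iU UE iD DE ms mq mV VE WE V1.
pose h g := lambda * (s g + lambda / 2 * q g).
have mh : measurable_fun setT h.
  by apply: measurable_funM => //; apply: measurable_funD => //; exact: measurable_funM.
have mexp : measurable_fun setT (fun g => expR (- h g)).
  by apply: measurableT_comp => //; exact: measurableT_comp.
have mEV : measurable_fun setT (EFin \o V) by exact/measurable_EFinP.
have V0 z : (0 <= (EFin \o V) z)%E by case: z => w g; rewrite /= VE lee_fin expR_ge0.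
pose k := 1 + lambda * A + ln W.
have pointwise g : ((k * W^-1 * expR (- h g))%:E <= \int[P]_w (V (w, g))%:E)%E.
  (* [c] collects the terms of the tangent bound that are constant in [w]; in the mean, [h g]
     cancels against [s g] and [q g]. *)
  pose c := 1 + ln W - lambda * s g + h g.
  have split_c : (fun w => (c + lambda * U w - lambda ^+ 2 / 2 * D g w)%:E) =
      (fun w => ((EFin \o cst c) w + lambda%:E * (EFin \o U) w) -
                (lambda ^+ 2 / 2)%:E * (EFin \o D g) w)%E by exact/funext.
  have iUc : P.-integrable setT
      (fun w => (EFin \o cst c) w + lambda%:E * (EFin \o U) w)%E.
    apply: integrableD => //; first exact: finite_measure_integrable_cst.
    exact: integrableZl.
  have fE : (\int[P]_w (c + lambda * U w - lambda ^+ 2 / 2 * D g w)%:E = k%:E)%E.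
    rewrite split_c integralB//; last exact: integrableZl.
    rewrite integralD//; last 2 first.
    - exact: finite_measure_integrable_cst.
    - exact: integrableZl.
    rewrite !integralZl//= UE DE integral_cst//.
    rewrite [X in (_ * X + _ - _)%E]probability_setT mule1 -!EFinM -EFinN -!EFinD.
    by congr EFin; rewrite /c /k /h; field.
  have fi : P.-integrable setT (fun w => (c + lambda * U w - lambda ^+ 2 / 2 * D g w)%:E).
    by rewrite split_c; apply: integrableB => //; exact: integrableZl.
  have mVg : measurable_fun setT (fun w => (V (w, g))%:E).
    exact: (measurable_fun_pair1 g mEV).
  have -> : (k * W^-1 * expR (- h g) = W^-1 * expR (- h g) * k)%R by ring.
  rewrite EFinM -lee_pdivlMl ?mulr_gt0 ?invr_gt0 ?expR_gt0//.
  rewrite -ge0_integralZl//; last 2 first.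
  - by move=> w _; exact: (V0 (w, g)).
  - by rewrite lee_fin invr_ge0 ltW// mulr_gt0 ?invr_gt0 ?expR_gt0.
  rewrite -fE; apply: le_measurable_integral; first exact: measurable_int fi.
    exact: emeasurable_funM.
  move=> w; rewrite -EFinM lee_fin VE invfM invrK -expRN opprK.
  rewrite -[W in leRHS]lnK ?posrE// -!expRD.
  by apply: le_trans (expR_ge1Dx _); rewrite /c; lra.
have kle : (k%:E <= 1)%E.
  apply: le_trans V1; rewrite (fubini_tonelli _ mEV V0)/=.
  have -> : k%:E = (\int[pi]_g (k * W^-1 * expR (- h g))%:E)%E.
    under eq_integral do rewrite EFinM.
    rewrite integralZl//.
      by rewrite WE -EFinM divfK// gt_eqF.
    apply/integrableP; split; first exact/measurable_EFinP.
    by under eq_integral do rewrite /= ger0_norm ?expR_ge0//; rewrite WE ltry.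
  apply: le_measurable_integral => //.
    by apply/measurable_EFinP; exact: measurable_funM.
    exact: (measurable_fun_fubini_tonelli_G _ mEV V0).
rewrite ler_pdivlMr// mulrC.
by move: kle; rewrite lee_fin /k; lra.
Qed.

(** * Integrability of the losses *)

Lemma excess_weight_expR (R : realType) (TZ : Type) (dG : measure_display)
    (G : measurableType dG) (L : TZ -> G -> R) (lambda : R) (Z : nat -> TZ)
    (gs : nat -> G) (n : nat) (g : G) :
  excess_weight L lambda Z gs n g =
  expR (lambda * (\sum_(j < n) L (Z j.+1) (gs j)) -
        lambda * (\sum_(j < n) L (Z j.+1) g) -
        lambda ^+ 2 / 2 * \sum_(j < n) (L (Z j.+1) g - L (Z j.+1) (gs j)) ^+ 2).
Proof.
elim: n => [|n IH].
  by rewrite excess_weight0 !big_ord0 !mulr0 !subr0 expR0.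
by rewrite excess_weightS IH !big_ord_recr/= /psi -expRD; congr expR; field.
Qed.

(** After multiplication by [lambda], the difference of the two sides is one eighth of the sum of
    the two squares below. The factor [lambda / 4] is half of that in the oracle bound, as
    [gibbs_variational] requires. *)
Lemma normr_le_sqr_dist (R : realType) (lambda x y : R) : 0 < lambda ->
  `|x| <= lambda / 4 * (x - y) ^+ 2 + (lambda / 4 * y ^+ 2 + 2 / lambda).
Proof.
move=> l0; rewrite -(ler_pM2l l0) !mulrDr (mulrCA lambda 2) mulfV ?gt_eqF//.
have xx : `|x| ^+ 2 = x ^+ 2 by rewrite real_normK ?num_real.
have : 0 <= (lambda * `|x| - 4) ^+ 2 by exact: sqr_ge0.
have : 0 <= lambda ^+ 2 * (x - 2 * y) ^+ 2 by rewrite mulr_ge0 ?sqr_ge0.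
rewrite !sqrrB !exprMn xx; lra.
Qed.

Definition sum_sqr_dist (R : realType) (G Omega : Type) (n : nat)
    (M : 'I_n -> G -> R) (l : 'I_n -> Omega -> R) (g : G) (w : Omega) : R :=
  \sum_(j < n) (M j g - l j w) ^+ 2.

Section square_integrable_losses.
Context (R : realType) (dG dO : measure_display)
  (G : measurableType dG) (Omega : measurableType dO).
Variables (P : probability Omega R) (n : nat).
Variables (M : 'I_n -> G -> R) (l : 'I_n -> Omega -> R) (lambda : R).
Hypotheses (mM : forall j, measurable_fun setT (M j)).
Hypotheses (ml : forall j, measurable_fun setT (l j)).
Hypothesis (lambda_gt0 : 0 < lambda).

Let N w := \sum_(j < n) l j w ^+ 2.

Let mD : measurable_fun setT (fun z : G * Omega => sum_sqr_dist M l z.1 z.2).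
Proof.
apply: measurable_sum => j; apply: measurable_funX; apply: measurable_funB.
  exact: measurableT_comp.
exact: measurableT_comp.
Qed.

Let mDg g : measurable_fun setT (sum_sqr_dist M l g).
Proof. exact: (measurable_fun_pair2 g mD). Qed.

Let D0 g w : 0 <= sum_sqr_dist M l g w.
Proof. by apply: sumr_ge0 => j _; exact: sqr_ge0. Qed.

Let mN : measurable_fun setT N.
Proof. by apply: measurable_sum => j; exact: measurable_funX. Qed.

(** [l^2 <= 2 (M - l)^2 + 2 M^2], with [M j g] constant in [w]: a finite mean distance would make
    [l j] square integrable. *)
Lemma integral_sqr_dist_pinfty j g : (\int[P]_w (l j w ^+ 2)%:E = +oo)%E ->
  (\int[P]_w (sum_sqr_dist M l g w)%:E = +oo)%E.
Proof.
move=> loo; apply/eqP; rewrite -leye_eq leNgt; apply/negP => Doo.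
have iD : P.-integrable setT (EFin \o sum_sqr_dist M l g).
  apply/integrableP; split; first exact/measurable_EFinP.
  by under eq_integral do rewrite /= ger0_norm//.
have iB : P.-integrable setT
    (fun w => 2%:E * (EFin \o sum_sqr_dist M l g) w + (EFin \o cst (2 * M j g ^+ 2)%R) w)%E.
  apply: integrableD => //; first exact: integrableZl.
  exact: finite_measure_integrable_cst.
have il : P.-integrable setT (fun w => (l j w ^+ 2)%:E).
  apply: (le_integrable measurableT _ _ iB).
    by apply/measurable_EFinP; exact: measurable_funX.
  move=> w _; rewrite /= lee_fin ger0_norm ?sqr_ge0//.
  apply: le_trans (ler_norm _).
  have jD : (M j g - l j w) ^+ 2 <= sum_sqr_dist M l g w.
    by rewrite /sum_sqr_dist (bigD1 j)//= lerDl sumr_ge0// => i _; exact: sqr_ge0.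
  by have := sqr_ge0 (l j w - 2 * M j g); nra.
by have := integrable_fin_num measurableT il; rewrite loo.
Qed.

Hypothesis sqr_int : forall j, (\int[P]_w (l j w ^+ 2)%:E < +oo)%E.

Let iN : P.-integrable setT (EFin \o N).
Proof.
rewrite (_ : EFin \o N = fun w => \sum_(j < n) (l j w ^+ 2)%:E)%E; last first.
  by apply/funext => w; rewrite /= sumEFin.
apply: integrable_sum => // j _; apply/integrableP; split.
  by apply/measurable_EFinP; exact: measurable_funX.
by under eq_integral do rewrite /= ger0_norm ?sqr_ge0//; exact: sqr_int.
Qed.

Let iNab a b : P.-integrable setT (fun w => (a * N w + b)%:E).
Proof.
rewrite (_ : (fun w => _) =
  (fun w => a%:E * (EFin \o N) w + (EFin \o cst b) w)%E); last exact/funext.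
apply: integrableD => //; first exact: integrableZl.
exact: finite_measure_integrable_cst.
Qed.

Lemma integrable_sum_losses :
  P.-integrable setT (EFin \o (fun w => \sum_(j < n) l j w)).
Proof.
apply: (le_integrable measurableT _ _ (iNab 1 (\sum_(j < n) 1))).
  by apply/measurable_EFinP; exact: measurable_sum.
move=> w _; rewrite /= lee_fin mul1r; apply: le_trans (ler_norm _).
rewrite -big_split/=; apply: le_trans (ler_norm_sum _ _ _) _.
apply: ler_sum => j _; have := sqr_ge0 (`|l j w| - 1).
by rewrite sqrrB real_normK ?num_real//; have := sqr_ge0 (l j w); lra.
Qed.

Lemma integrable_sqr_dist g : P.-integrable setT (EFin \o sum_sqr_dist M l g).
Proof.
apply: (le_integrable measurableT _ _ (iNab 2 (\sum_(j < n) (2 * M j g ^+ 2)))).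
  exact/measurable_EFinP.
move=> w _; rewrite /= lee_fin ger0_norm//; apply: le_trans (ler_norm _).
rewrite /N big_distrr -big_split/=; apply: ler_sum => j _.
by have := sqr_ge0 (M j g + l j w); nra.
Qed.

Lemma measurable_mean_sqr_dist :
  measurable_fun setT (fun g => fine (\int[P]_w (sum_sqr_dist M l g w)%:E)%E).
Proof.
apply: measurableT_comp; first exact: fine_measurable.
apply: (measurable_fun_fubini_tonelli_F (fun z => (sum_sqr_dist M l z.1 z.2)%:E)).
  exact/measurable_EFinP.
by move=> z; rewrite lee_fin.
Qed.

(** [normr_le_sqr_dist] at [y = l j w], summed over [j] and averaged over [w]; the terms in [y]
    average to a constant free of [g]. *)
Lemma norm_sum_le_mean_sqr_dist : exists c, forall g,
  `|\sum_(j < n) M j g| <= lambda / 4 * fine (\int[P]_w (sum_sqr_dist M l g w)%:E)%E + c.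
Proof.
pose c0 := \sum_(j < n) (2 / lambda).
exists (fine (\int[P]_w (lambda / 4 * N w + c0)%:E)%E) => g.
have qE := fineK (integrable_fin_num measurableT (integrable_sqr_dist g)).
have nE := fineK (integrable_fin_num measurableT (iNab (lambda / 4) c0)).
rewrite -lee_fin EFinD EFinM nE [X in (_ * X + _)%E]qE.
rewrite -integralZl//; last exact: integrable_sqr_dist.
rewrite -integralD//; last exact/integrableZl/integrable_sqr_dist.
rewrite (_ : `|\sum_(j < n) M j g|%:E = \int[P]_w (cst `|\sum_(j < n) M j g|%:E w))%E; last first.
  by rewrite integral_cst// [X in (_ * X)%E]probability_setT mule1.
apply: le_measurable_integral => //.
  apply: emeasurable_funD.
    by apply: emeasurable_funM => //; exact/measurable_EFinP.
  exact: measurable_int (iNab _ _).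
move=> w; rewrite /= lee_fin; apply: le_trans (ler_norm_sum _ _ _) _.
rewrite /sum_sqr_dist /N !big_distrr -!big_split/=; apply: ler_sum => j _.
exact: normr_le_sqr_dist.
Qed.

End square_integrable_losses.

(** * The oracle inequality *)

Theorem corollary4p7 (R : realType)
    (dX dY dG dO : measure_display)
    (X : measurableType dX) (Y : measurableType dY)
    (G : measurableType dG) (predictor : G -> {mfun X >-> Y})
    (predictor_inj : injective predictor)
    (L : X * Y -> G -> R)
    (mL : forall z : X * Y, measurable_fun [set: G] (L z))
    (lambda : R) (lambda_gt0 : 0 < lambda) (pi : probability G R)
    (n : nat) (n_gt0 : (0 < n)%N) (Z : nat -> X * Y)
    (Omega : measurableType dO) (P : probability Omega R)
    (ghat : nat -> {RV P >-> G})
    (run : online_SeqRand L lambda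
             (fun z g g' => lambda / 2 * (L z g - L z g') ^+ 2)
             (fun rho => rho) pi n Z ghat) :
  exists m : \bar R,
    is_minimum (oracle_bound L lambda pi n Z ghat) m /\
    ('E_P[fun w => (\sum_(1 <= i < n.+1) L (Z i) (ghat i.-1 w))%R] <= m)%E.
Proof.
pose M (j : 'I_n) g := L (Z j.+1) g.
pose l (j : 'I_n) w := L (Z j.+1) (ghat j w).
have mM j : measurable_fun setT (M j) by exact: mL.
have ml j : measurable_fun setT (l j) by exact: measurableT_comp.
pose D g w := sum_sqr_dist M l g w.
pose q g := fine (\int[P]_w (D g w)%:E)%E.
pose s g := \sum_(j < n) M j g.
pose U w := \sum_(j < n) l j w.
have sum1n (F : nat -> R) : \sum_(1 <= i < n.+1) F i = \sum_(j < n) F j.+1.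
  by rewrite big_add1 big_mkord.
have boundE rho : oracle_bound L lambda pi n Z ghat rho =
    ((\int[rho]_g (s g)%:E)%E +
     (lambda / 2)%:E * (\int[rho]_g \int[P]_w (D g w)%:E)%E +
     (lambda^-1)%:E * KL rho pi)%dE.
  rewrite /oracle_bound unlock; congr (_ + _ * _ + _)%dE.
    by apply: eq_integral => g _; rewrite sum1n.
  by apply: eq_integral => g _; apply: eq_integral => w _; rewrite sum1n.
have UE : ('E_P[fun w => (\sum_(1 <= i < n.+1) L (Z i) (ghat i.-1 w))%R] =
    \int[P]_w (U w)%:E)%E.
  by rewrite unlock; apply: eq_integral => w _; rewrite sum1n.
rewrite UE.
(* If some loss is not square integrable, the quadratic term is [+oo] for every [rho]; by dual
   addition so is the bound, and [+oo] is its minimum, attained at [pi]. *)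
have [sqr_int|] := pselect (forall j, \int[P]_w (l j w ^+ 2)%:E < +oo)%E; last first.
  move=> /existsNP[j /negP]; rewrite -leNgt leye_eq => /eqP loo.
  have bound_oo rho : oracle_bound L lambda pi n Z ghat rho = +oo%E.
    have E2oo : (\int[rho]_g \int[P]_w (D g w)%:E = +oo)%E.
      under eq_integral do rewrite (integral_sqr_dist_pinfty mM ml _ loo).
      by rewrite integral_cst// [X in (_ * X)%E]probability_setT mule1.
    rewrite boundE E2oo.
    rewrite gt0_muley ?lte_fin ?divr_gt0// DualAddTheoryNumDomain.daddey.
    by rewrite DualAddTheoryNumDomain.daddeC DualAddTheoryNumDomain.daddey.
  exists +oo%E; split; last by rewrite leey.
  by split; [exists pi|move=> rho; rewrite bound_oo].
have iD g := integrable_sqr_dist mM ml sqr_int g.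
have DE g : (\int[P]_w (D g w)%:E = (q g)%:E)%E.
  by rewrite fineK// (integrable_fin_num measurableT (iD g)).
have iU := integrable_sum_losses ml sqr_int.
have ms : measurable_fun setT s by exact: measurable_sum.
have mq : measurable_fun setT q by exact: measurable_mean_sqr_dist.
have q0 g : 0 <= q g.
  rewrite -lee_fin -DE; apply: integral_ge0 => w _.
  by rewrite lee_fin sumr_ge0// => j _; exact: sqr_ge0.
have [c sq] := norm_sum_le_mean_sqr_dist mM ml lambda_gt0 sqr_int.
(* [- ln W / lambda] is both the minimum of the bound and an upper bound on the mean loss. *)
have [W W0 WE] := integral_expRN_gt0 pi lambda_gt0 ms mq q0 sq.
exists (- ln W / lambda)%:E; split.
  have := gibbs_variational lambda_gt0 ms mq q0 sq W0 WE.
  congr (is_minimum _ _); apply/funext => rho; rewrite boundE.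
  by congr (_ + _ * _ + _)%dE; apply: eq_integral => g _; rewrite DE.
have Ufin := integrable_fin_num measurableT iU.
rewrite -(fineK Ufin) lee_fin.
apply: (@mean_le_free_energy _ _ _ Omega G P pi U D s q
  (fun z => excess_weight L lambda Z (fun j => ghat j z.1) n z.2) lambda _ W) => //.
- by rewrite fineK.
- exact: (measurable_excess_weight mL lambda Z (gs := fun j => ghat j)).
- by move=> w g; exact: excess_weight_expR.
exact: expectation_excess_weight_le1.
Qed.
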